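(* In the setting described in the context (selected gap $FT$ of a nonconvex standard polygonal escape minimizer $\gamma$ with hull $H$), let $M=V_0,V_1,\dots,V_n=Z_1$ be the consecutive hull vertices on the clockwise boundary arc from an upward contact $M$ to a right-anchor contact $Z_1$. If $$M\prec T\prec Z_1,$$ then some adjacent pair $U=V_{j-1}$, $V=V_j$ satisfies $$F\prec U\prec T\prec V.$$ The edge $UV$ is a gap. Its outward normal lies in the closed normal-fan interval from $(0,1)$ to $\zeta_R=(\rho,\kappa)$, so the acute angle of $UV$ with the selected horizontal gap is at most $$\delta=\pi-2\beta,\qquad \cos\delta=\kappa=\frac{547947}{625565}.$$
   Context: Put $\beta=\arctan(766/197)$, $\rho=\frac{301804}{625565}$, $\kappa=\frac{547947}{625565}$ (so $\rho^2+\kappa^2=1$), $D=\frac{82074390584}{84861020075}$, and let $\mathcal K=\operatorname{conv}\{(-c,0),(c,0),(0,s)\}$ with $s=\sin\beta=766/\sqrt{625565}$, $c=\cos\beta=197/\sqrt{625565}$. A path is an escape path if no translated and rotated copy of it lies in the interior of $\mathcal K$. A polygonal path is standard if it is simple and its nonrepeated vertices are exactly the extreme vertices of its convex hull, each visited once; a hull edge not traversed by the path is a gap; a standard path is convex if its links follow one hull-boundary chain between its endpoints, nonconvex otherwise. $X\prec Y$ means $X$ is visited strictly before $Y$. Setting: $\gamma$ is a nonconvex standard polygonal escape path, length-minimal among polygonal escape paths with at most $N$ segments for some $N$, of length $L<D$. Its selected gap is a gap $FT$ with a hull vertex $M$ and $h>0$ such that, in suitable rigid coordinates, the hull $H=\operatorname{conv}\gamma$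 lies in the strip $0\le y\le h$ (both boundary lines supporting it), $F=(x_F,0)$, $T=(x_T,0)$, $M=(x_M,h)$, $x_F\le x_T$, $F\prec M\prec T$, and $L\ge(1+\sqrt2)h$. A contact of a direction $v$ is a vertex of $H$ maximizing $x\cdot v$ over $H$; an upward contact is a contact of $(0,1)$, and a right-anchor contact $Z_1$ is a contact of $\zeta_R=(\rho,\kappa)$. The boundary of $H$ is traversed clockwise from $F$ through the upper support face to $T$. *)

(* Defs.v *)
From HB Require Import structures.
From mathcomp Require Import all_boot all_order all_algebra.
From mathcomp Require Import all_classical all_reals all_analysis.

Set Implicit Arguments.
Unset Strict Implicit.
Unset Printing Implicit Defensive.

Import Order.TTheory GRing.Theory Num.Theory.
Import numFieldNormedType.Exports.

Local Open Scope classical_set_scope.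
Local Open Scope ring_scope.

(* Points and vectors of the plane are pairs [(x, y) : R * R]. The library norm
   on [R * R] is the sup norm, hence the Euclidean notions below; its topology
   is the usual one. *)
Definition dot (R : realType) (u v : R * R) : R := u.1 * v.1 + u.2 * v.2.
Definition cross (R : realType) (u v : R * R) : R := u.1 * v.2 - u.2 * v.1.
Definition enorm (R : realType) (u : R * R) : R := Num.sqrt (dot u u).

(* The point [(1 - t) p + t q]. *)
Definition lerp (R : realType) (p q : R * R) (t : R) : R * R :=
  ((1 - t) * p.1 + t * q.1, (1 - t) * p.2 + t * q.2).

Definition segment (R : realType) (p q : R * R) : set (R * R) :=
  [set lerp p q t | t in [set t : R | 0 <= t <= 1]].

Definition conv (R : realType) (s : seq (R * R)) : set (R * R) :=
  [set p | exists w : 'I_(size s) -> R,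
     [/\ forall i, 0 <= w i,
         \sum_(i < size s) w i = 1,
         p.1 = \sum_(i < size s) w i * (nth (0, 0) s i).1 &
         p.2 = \sum_(i < size s) w i * (nth (0, 0) s i).2]].

Definition extreme (R : realType) (A : set (R * R)) (p : R * R) : Prop :=
  A p /\ forall (a b : R * R) (t : R), A a -> A b -> 0 < t < 1 ->
    p = lerp a b t -> a = p /\ b = p.

Definition rotate (R : realType) (th : R) (p : R * R) : R * R :=
  (cos th * p.1 - sin th * p.2, sin th * p.1 + cos th * p.2).

Definition move (R : realType) (th : R) (a p : R * R) : R * R :=
  rotate th p + a.

Definition mirror (R : realType) (p : R * R) : R * R := (- p.1, p.2).

(* Changes of rigid coordinates; orientation-reversing ones are allowed. *)
Definition rigid (R : realType) (phi : R * R -> R * R) : Prop :=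
  exists (th : R) (a : R * R),
    phi = move th a \/ phi = move th a \o @mirror R.

(* Large decimal literals denote unary naturals, so they are split into groups
   of three digits: [547 * 10 ^+ 3 + 947] is 547947. *)
Definition beta (R : realType) : R := atan (766 / 197).

Definition rho (R : realType) : R :=
  (301 * 10 ^+ 3 + 804) / (625 * 10 ^+ 3 + 565).

Definition kappa (R : realType) : R :=
  (547 * 10 ^+ 3 + 947) / (625 * 10 ^+ 3 + 565).

Definition Dconst (R : realType) : R :=
  (82 * 10 ^+ 9 + 74 * 10 ^+ 6 + 390 * 10 ^+ 3 + 584) /
  (84 * 10 ^+ 9 + 861 * 10 ^+ 6 + 20 * 10 ^+ 3 + 75).

Definition delta (R : realType) : R := pi - 2 * beta R.

Definition zetaR (R : realType) : R * R := (rho R, kappa R).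

Definition Ktri (R : realType) : set (R * R) :=
  conv [:: (- cos (beta R), 0); (cos (beta R), 0); (0, sin (beta R))].

(* A polygonal path is the sequence of its vertices in the order of visit; it
   has [(size g).-1] segments. *)
Fixpoint trace (R : realType) (g : seq (R * R)) : set (R * R) :=
  match g with
  | [::] => set0
  | p :: g' =>
      match g' with
      | [::] => [set p]
      | q :: _ => segment p q `|` trace g'
      end
  end.

Definition plength (R : realType) (g : seq (R * R)) : R :=
  \sum_(0 <= i < (size g).-1) enorm (nth (0, 0) g i.+1 - nth (0, 0) g i).

Definition escape (R : realType) (g : seq (R * R)) : Prop :=
  g != [::] /\
  forall (th : R) (a : R * R), ~ (move th a @` trace g `<=` interior (@Ktri R)).

Definition minimizer (R : realType) (g : seq (R * R)) : Prop :=
  exists N : nat,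
    [/\ escape g, (size g <= N.+1)%N &
        forall g' : seq (R * R), escape g' -> (size g' <= N.+1)%N ->
          plength g <= plength g'].

(* Injectivity of the piecewise affine parametrization on [0, size g - 1]. *)
Definition simple (R : realType) (g : seq (R * R)) : Prop :=
  forall (i j : nat) (t u : R),
    (i.+1 < size g)%N -> (j.+1 < size g)%N -> 0 <= t <= 1 -> 0 <= u <= 1 ->
    lerp (nth (0, 0) g i) (nth (0, 0) g i.+1) t =
    lerp (nth (0, 0) g j) (nth (0, 0) g j.+1) u ->
    i%:R + t = j%:R + u.

Definition standard (R : realType) (g : seq (R * R)) : Prop :=
  [/\ simple g, uniq g & forall p, p \in g <-> extreme (conv g) p].

Definition contact (R : realType) (g : seq (R * R)) (v x : R * R) : Prop :=
  extreme (conv g) x /\ forall y, conv g y -> dot y v <= dot x v.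

Definition outward_normal (R : realType) (g : seq (R * R)) (U V n : R * R) : Prop :=
  [/\ n <> (0, 0), contact g n U & contact g n V].

Definition hull_edge (R : realType) (g : seq (R * R)) (U V : R * R) : Prop :=
  U <> V /\ exists n : R * R, outward_normal g U V n.

(* [V] is the hull vertex following [U] clockwise: the hull lies on the right
   of the directed line [UV]. *)
Definition cw_next (R : realType) (g : seq (R * R)) (U V : R * R) : Prop :=
  [/\ extreme (conv g) U, extreme (conv g) V, U <> V &
      forall y, conv g y -> cross (V - U) (y - U) <= 0].

(* [V 0, ..., V n] are the consecutive hull vertices of the clockwise boundary
   arc from [A] to [B]; injectivity excludes going around the hull again. *)
Definition cw_arc (R : realType) (g : seq (R * R)) (A B : R * R)
    (n : nat) (V : nat -> R * R) : Prop :=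
  [/\ V 0%N = A, V n = B,
      forall j, (j < n)%N -> cw_next g (V j) (V j.+1) &
      forall i j, (i <= n)%N -> (j <= n)%N -> V i = V j -> i = j].

Definition links_cw (R : realType) (g : seq (R * R)) : Prop :=
  forall i, (i.+1 < size g)%N -> cw_next g (nth (0, 0) g i) (nth (0, 0) g i.+1).

Definition convex_path (R : realType) (g : seq (R * R)) : Prop :=
  links_cw g \/ links_cw (rev g).

Definition is_link (R : realType) (g : seq (R * R)) (U V : R * R) : Prop :=
  exists2 i, (i.+1 < size g)%N &
    (nth (0, 0) g i = U /\ nth (0, 0) g i.+1 = V) \/
    (nth (0, 0) g i = V /\ nth (0, 0) g i.+1 = U).

Definition gap (R : realType) (g : seq (R * R)) (U V : R * R) : Prop :=
  hull_edge g U V /\ ~ is_link g U V.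

(* Order of visit, for vertices of a path without repeated vertices. *)
Definition before (R : realType) (g : seq (R * R)) (X Y : R * R) : Prop :=
  [/\ X \in g, Y \in g & (index X g < index Y g)%N].

(* [g] is the path written in the rigid coordinates of the selected gap. *)
Definition selected_gap (R : realType) (g : seq (R * R)) (F T M : R * R)
    (h : R) : Prop :=
  [/\ gap g F T, extreme (conv g) M & 0 < h] /\
  [/\ forall y, conv g y -> 0 <= y.2 <= h,
      F.2 = 0, T.2 = 0, M.2 = h & F.1 <= T.1] /\
  [/\ before g F M, before g M T & (1 + Num.sqrt 2) * h <= plength g].

(* Acute angle between the lines directed by nonzero [u] and [v]. *)
Definition acute_angle (R : realType) (u v : R * R) : R :=
  acos (`|dot u v| / (enorm u * enorm v)).

(* Directions of the closed normal-fan interval from [u] to [v], where [u] and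
   [v] make an angle less than [pi]. *)
Definition normal_fan (R : realType) (u v : R * R) : set (R * R) :=
  [set n | n <> (0, 0) /\ exists a b : R, [/\ 0 <= a, 0 <= b &
     n = (a * u.1 + b * v.1, a * u.2 + b * v.2)]].

(* Main.v *)
Require Import Defs.
From HB Require Import structures.
From mathcomp Require Import all_boot all_order all_algebra.
From mathcomp Require Import all_classical all_reals all_analysis.
From mathcomp Require Import ring lra zify.

Set Implicit Arguments.
Unset Strict Implicit.
Unset Printing Implicit Defensive.

Import Order.TTheory GRing.Theory Num.Theory.
Import numFieldNormedType.Exports.

Local Open Scope classical_set_scope.
Local Open Scope ring_scope.

(** Along the clockwise arc from [M] to [Z1] the path visits [M] before [T] and
    [Z1] after [T], so some edge [UV] of the arc has [U] visited before [T] and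
    [V] not before [T]. What remains is to locate [F] and [T] with respect to
    this edge and to bound its direction.

    Both rest on one fact about normals, [contact_fan]: a vertex that the
    clockwise arc from [M] to [Z1] passes has all its outward normals in the fan
    from [(0, 1)] to [zetaR]. Three vertices in arc order make a clockwise turn
    ([cw_arc_clockwise]), so the fact applies to the edges of the arc
    ([cw_arc_normal_fan]), which bounds the slope of [UV], hence its angle with
    the horizontal gap ([acute_angle_delta]). It also shows that [F] and [T],
    which have the downward normal, are not on the arc. Hence [V] is not [T]
    and is visited after it.

    The order of [F] and [U] comes from planarity. A simple path through points
    in convex position has, at every time, visited a contiguous block of the
    hull boundary ([prefix_suffix_noncrossing]). If [U] came before [F], then
    both would be visited before the top vertex [M0] and before [V]. But
    clockwise the order is [F], [M0], [U], [V] (the position of [M0] is once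
    more [contact_fan], between the normals of [M0] and of [UV]), so that the
    chord [FU] would separate [M0] from [V]. Finally [UV] is a gap since [T] is
    visited between its ends. *)

(** * Orientation of triples of points *)

Section Plane.
Variable R : realType.
Implicit Types (p q r a b c d o u v : R * R) (A : set (R * R)) (t : R).

(** Twice the signed area of the triangle: negative for a clockwise turn. *)
Definition orient p q r : R := cross (q - p) (r - p).

Lemma orientE p q r :
  orient p q r = (q.1 - p.1) * (r.2 - p.2) - (q.2 - p.2) * (r.1 - p.1).
Proof. by []. Qed.

Lemma orient_cycle p q r : orient p q r = orient q r p.
Proof. rewrite !orientE; ring. Qed.

Lemma orient_swap p q r : orient q p r = - orient p q r.
Proof. rewrite !orientE; ring. Qed.

Lemma pair_ext p q : p.1 = q.1 -> p.2 = q.2 -> p = q.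
Proof. by case: p q => [? ?] [? ?] /= -> ->. Qed.

Lemma divD_itv (x y : R) : 0 < x -> 0 < y -> 0 < x / (x + y) < 1.
Proof. by move=> x0 y0; rewrite divr_gt0 ?ltr_pdivrMr; lra. Qed.

Lemma divD_itvW (x y : R) : 0 <= x -> 0 < y -> 0 <= x / (x + y) <= 1.
Proof. by move=> x0 y0; rewrite divr_ge0 ?ler_pdivrMr; lra. Qed.

Lemma collinear_lerp a b c :
  a <> b -> orient a b c = 0 -> exists t, c = lerp a b t.
Proof.
rewrite orientE => ab o0.
set s := (b.1 - a.1) ^+ 2 + (b.2 - a.2) ^+ 2.
have s0 : s != 0.
  apply/eqP => /eqP; rewrite paddr_eq0 ?sqr_ge0// !sqrf_eq0 !subr_eq0.
  by move=> /andP[/eqP e1 /eqP e2]; apply: ab; exact/esym/pair_ext.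
exists (((b.1 - a.1) * (c.1 - a.1) + (b.2 - a.2) * (c.2 - a.2)) / s).
apply: pair_ext; rewrite /lerp /=; apply/eqP; rewrite -subr_eq0.
  rewrite (_ : _ - _ = - (b.2 - a.2) / s *
    ((b.1 - a.1) * (c.2 - a.2) - (b.2 - a.2) * (c.1 - a.1))).
    by rewrite o0 mulr0.
  by rewrite /s in s0 *; field.
rewrite (_ : _ - _ = (b.1 - a.1) / s *
  ((b.1 - a.1) * (c.2 - a.2) - (b.2 - a.2) * (c.1 - a.1))).
  by rewrite o0 mulr0.
by rewrite /s in s0 *; field.
Qed.

Lemma lerp0 a b : lerp a b 0 = a.
Proof. by apply: pair_ext; rewrite /lerp /=; ring. Qed.

Lemma lerp1 a b : lerp a b 1 = b.
Proof. by apply: pair_ext; rewrite /lerp /=; ring. Qed.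

(** On a line, one of three distinct points lies strictly between the other
    two, and such a point is not extreme. *)
Lemma extreme_orient_neq0 A a b c :
  extreme A a -> extreme A b -> extreme A c ->
  a <> b -> b <> c -> a <> c -> orient a b c != 0.
Proof.
move=> [Aa Ea] [Ab Eb] [Ac Ec] ab bc ac; apply/eqP => /(collinear_lerp ab)[t].
have [t0|t0|t0] := ltgtP t 0; last by rewrite t0 lerp0 => /esym/ac.
  have mt0 : 0 < - t by rewrite oppr_gt0.
  have n0 : - t + 1 != 0 by rewrite gt_eqF ?addr_gt0.
  move=> ct; have e : a = lerp c b (- t / (- t + 1)).
    by apply: pair_ext; rewrite ct /lerp /=; field.
  by have [/esym/ac] := Ea _ _ _ Ac Ab (divD_itv mt0 ltr01) e.
have [t1|t1|t1] := ltgtP t 1; last by rewrite t1 lerp1 => /esym/bc.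
  by move=> ct; have [/ac] := Ec a b t Aa Ab (introT andP (conj t0 t1)) ct.
have s1 : 0 < t^-1 < 1 by rewrite invr_gt0 t0 invf_lt1.
move=> ct; have e : b = lerp a c t^-1.
  by apply: pair_ext; rewrite ct /lerp /=; field; rewrite gt_eqF.
by have [/ab] := Eb _ _ _ Aa Ac s1 e.
Qed.

Definition lerp_closed A :=
  forall a b t, A a -> A b -> 0 <= t <= 1 -> A (lerp a b t).

Lemma extreme_barycenter A p q r s (x y z : R) : lerp_closed A ->
  extreme A p -> A q -> A r -> A s -> 0 <= x -> 0 < y -> 0 < z ->
  (x + y + z) * p.1 = x * q.1 + y * r.1 + z * s.1 ->
  (x + y + z) * p.2 = x * q.2 + y * r.2 + z * s.2 -> r = p.
Proof.
move=> Acv [Ap Ep] Aq Ar As x0 y0 z0.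
have n0 : x + y + z != 0 by lra.
have n1 : x + z != 0 by lra.
have t01 : 0 <= z / (x + z) <= 1 by rewrite divr_ge0 ?ler_pdivrMr; lra.
have u01 : 0 < y / (x + y + z) < 1 by rewrite divr_gt0 ?ltr_pdivrMr; lra.
move=> e1 e2.
have e : p = lerp (lerp q s (z / (x + z))) r (y / (x + y + z)).
  apply: pair_ext; rewrite /lerp /=.
    by apply: (mulfI n0); rewrite e1; field; rewrite n0.
  by apply: (mulfI n0); rewrite e2; field; rewrite n0.
by have [] := Ep _ _ _ (Acv _ _ _ Aq As t01) Ar u01 e.
Qed.

(** The line [ab] may in general separate [c] from [d] outside the segment [ab].
    In convex position it cannot: the four points satisfy an affine relation
    whose coefficients are the signed areas of the four triangles, and three
    coefficients of one sign would make the fourth point a barycenter of the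
    other three. *)
Lemma opposite_sides_sym A a b c d : lerp_closed A ->
  extreme A a -> extreme A b -> extreme A c -> extreme A d ->
  orient a b c * orient a b d < 0 -> orient c d a * orient c d b < 0.
Proof.
move=> Acv.
(* [rsq] p = [rsp] q - [pqs] r + [pqr] s *)
have key p q r s : extreme A p -> A q -> A r -> A s ->
    0 < orient p q r -> orient p q s < 0 -> orient r s p < 0.
  move=> Ep Aq Ar As o1 o2; rewrite ltNge; apply/negP => o3.
  have rp : r = p.
    apply: (@extreme_barycenter A p q r s (orient r s p)
      (- orient p q s) (orient p q r)) => //; rewrite ?oppr_gt0//.
      by rewrite !orientE; ring.
    by rewrite !orientE; ring.
  by move: o1; rewrite rp (_ : orient p q p = 0) ?ltxx// orientE; ring.
have main p q r s : extreme A p -> extreme A q -> A r -> A s ->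
    0 < orient p q r -> orient p q s < 0 -> orient r s p * orient r s q < 0.
  move=> Ep Eq Ar As o1 o2; rewrite nmulr_rlt0.
    rewrite -oppr_lt0 -orient_swap.
    apply: (key q p) => //; first exact: proj1 Ep.
      by rewrite orient_swap oppr_gt0.
    by rewrite orient_swap oppr_lt0.
  by apply: key => //; exact: proj1 Eq.
move=> Ea Eb [Ac _] [Ad _]; have [s|s|->] := ltgtP (orient a b c) 0.
- rewrite nmulr_rlt0// => /(main a b d c Ea Eb Ad Ac)/(_ s).
  by rewrite !(orient_swap c d) mulrNN.
- by rewrite pmulr_rlt0//; exact: main.
- by rewrite mul0r ltxx.
Qed.

Lemma segments_meet a b c d :
  orient a b c * orient a b d < 0 -> orient c d a * orient c d b < 0 ->
  exists t u : R, [/\ 0 <= t <= 1, 0 <= u <= 1 & lerp a b t = lerp c d u].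
Proof.
set x := orient a b c; set y := orient a b d.
set z := orient c d a; set w := orient c d b => xy zw.
have frac (p q : R) : p * q < 0 -> p - q != 0 /\ 0 <= p / (p - q) <= 1.
  move=> pq; have pq0 : p - q != 0.
    by apply/negP => /eqP e; have := sqr_ge0 p; nra.
  split=> //; have [p0|p0|p0] := ltgtP p 0.
  - have q0 : 0 < q by nra.
    by rewrite -mulrNN -invrN divr_ge0 ?ler_pdivrMr; lra.
  - have q0 : q < 0 by nra.
    by rewrite divr_ge0 ?ler_pdivrMr; lra.
  - by move: pq; rewrite p0 mul0r ltxx.
have [xy0 xy1] := frac _ _ xy; have [zw0 zw1] := frac _ _ zw.
exists (z / (z - w)), (x / (x - y)); split=> //.
have zwE : z - w = y - x by rewrite /x /y /z /w !orientE; ring.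
rewrite zwE; have xy2 : y - x != 0 by rewrite -zwE.
have lerpE (p q s : R) : (y - x) * ((1 - s / (y - x)) * p + s / (y - x) * q) =
    (y - x - s) * p + s * q by field.
have -> : x / (x - y) = - x / (y - x) by rewrite -(opprB y x) invrN mulrN mulNr.
by apply: pair_ext; apply: (mulfI xy2); rewrite /lerp /= !lerpE /x /y /z !orientE;
  ring.
Qed.
End Plane.

(** * Convex hulls of finite sequences *)

Section Hull.
Variable R : realType.
Implicit Types (s g : seq (R * R)) (p q a b c d : R * R).

(** Weights indexed by all naturals survive a change of the sequence, unlike
    weights indexed by the ordinals below its size. *)
Lemma convP s p : Defs.conv s p <-> exists w : nat -> R,
  [/\ forall i, 0 <= w i, \sum_(i < size s) w i = 1,
      p.1 = \sum_(i < size s) w i * (nth (0, 0) s i).1 &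
      p.2 = \sum_(i < size s) w i * (nth (0, 0) s i).2].
Proof.
split=> [[w [w0 w1 e1 e2]]|[w [w0 w1 e1 e2]]]; last first.
  by exists (fun i => w i); split.
pose w' i := if insub i is Some k then w k else 0.
have w'E (i : 'I_(size s)) : w' i = w i by rewrite /w' valK.
exists w'; split.
- by move=> i; rewrite /w'; case: insubP.
- by under eq_bigr do rewrite w'E.
- by under eq_bigr do rewrite w'E.
- by under eq_bigr do rewrite w'E.
Qed.

Lemma conv_lerp_closed s : lerp_closed (Defs.conv s).
Proof.
move=> a b t [v [v0 v1 ea1 ea2]] [w [w0 w1 eb1 eb2]] /andP[t0 t1].
exists (fun i => (1 - t) * v i + t * w i); split.
- by move=> i; rewrite addr_ge0 ?mulr_ge0 ?subr_ge0.
- by rewrite big_split /= -!mulr_sumr v1 w1; ring.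
- rewrite /= ea1 eb1 !mulr_sumr -big_split /=; apply: eq_bigr => i _; ring.
- rewrite /= ea2 eb2 !mulr_sumr -big_split /=; apply: eq_bigr => i _; ring.
Qed.

(** * Changes of rigid coordinates *)

Lemma rigid_affine (phi : R * R -> R * R) : rigid phi ->
  exists m11 m12 m21 m22 e1 e2 : R, m11 * m22 - m12 * m21 != 0 /\
    forall p, phi p = (m11 * p.1 + m12 * p.2 + e1, m21 * p.1 + m22 * p.2 + e2).
Proof.
move=> [th [e [->|->]]].
- exists (cos th), (- sin th), (sin th), (cos th), e.1, e.2; split.
    by rewrite mulNr opprK -!expr2 cos2Dsin2 oner_eq0.
  by move=> p; apply: pair_ext; rewrite /move /rotate /=; ring.
- exists (- cos th), (- sin th), (- sin th), (cos th), e.1, e.2; split.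
    by rewrite mulrNN mulNr -!expr2 -opprD cos2Dsin2 oppr_eq0 oner_eq0.
  by move=> p; apply: pair_ext; rewrite /move /rotate /mirror /=; ring.
Qed.

Lemma rigid_inj (phi : R * R -> R * R) : rigid phi -> injective phi.
Proof.
move=> /rigid_affine[m11 [m12 [m21 [m22 [e1 [e2 [det0 phiE]]]]]]] p q.
rewrite !phiE => -[/addIr h1 /addIr h2].
apply: pair_ext; apply: (mulfI det0).
  rewrite (_ : _ * p.1 = m22 * (m11 * p.1 + m12 * p.2)
                         - m12 * (m21 * p.1 + m22 * p.2)); last ring.
  by rewrite h1 h2; ring.
rewrite (_ : _ * p.2 = m11 * (m21 * p.1 + m22 * p.2)
                       - m21 * (m11 * p.1 + m12 * p.2)); last ring.
by rewrite h1 h2; ring.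
Qed.

Lemma rigid_lerp (phi : R * R -> R * R) p q t : rigid phi ->
  phi (lerp p q t) = lerp (phi p) (phi q) t.
Proof.
move=> /rigid_affine[m11 [m12 [m21 [m22 [e1 [e2 [_ phiE]]]]]]].
by rewrite !phiE; apply: pair_ext; rewrite /lerp /=; ring.
Qed.

Lemma conv_map_rigid (phi : R * R -> R * R) s : rigid phi ->
  Defs.conv (map phi s) = phi @` Defs.conv s.
Proof.
move=> /rigid_affine[m11 [m12 [m21 [m22 [e1 [e2 [det0 phiE]]]]]]].
have comb (w : nat -> R) (x y z : R) : \sum_(i < size s) w i = 1 ->
    \sum_(i < size s) w i * (x * (nth (0, 0) s i).1 + y * (nth (0, 0) s i).2 + z)
    = x * (\sum_(i < size s) w i * (nth (0, 0) s i).1)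
      + y * (\sum_(i < size s) w i * (nth (0, 0) s i).2) + z.
  move=> w1; rewrite -[X in _ + X]mulr1 -w1 !mulr_sumr -!big_split /=.
  by apply: eq_bigr => i _; ring.
apply/seteqP; split=> [p /convP[w]|_ [q /convP[w [w0 w1 q1 q2]] <-]].
  rewrite size_map => -[w0 w1 p1 p2].
  exists (\sum_(i < size s) w i * (nth (0, 0) s i).1,
          \sum_(i < size s) w i * (nth (0, 0) s i).2).
    by apply/convP; exists w; split.
  rewrite phiE /=; apply: pair_ext => /=; rewrite -comb// ?p1 ?p2;
    by apply: eq_bigr => i _; rewrite (nth_map (0, 0))// phiE.
apply/convP; exists w; rewrite size_map; split=> //;
  rewrite phiE /= q1 q2 -comb//;
  by apply: eq_bigr => i _; rewrite (nth_map (0, 0))// phiE.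
Qed.

(** Being standard is an affine notion, since it only involves the
    parametrization of segments, the hull and its extreme points; hence it is
    available in the coordinates of the selected gap. *)
Lemma standard_rigid (phi : R * R -> R * R) g :
  rigid phi -> standard g -> standard (map phi g).
Proof.
move=> rphi [gsimple guniq gext]; have phiI := rigid_inj rphi.
have cE := conv_map_rigid g rphi; split.
- move=> i j t u; rewrite size_map => ig jg t01 u01.
  rewrite !(nth_map (0, 0))//; do ?exact: ltnW.
  by rewrite -!rigid_lerp// => /phiI/(gsimple i j t u ig jg t01 u01).
- by rewrite map_inj_uniq.
- move=> p; rewrite cE; split.
    move=> /mapP[q /gext[cq eq] ->]; split; first by exists q.
    move=> _ _ t [a ca <-] [b cb <-] t01; rewrite -rigid_lerp// => /phiI e.
    by have [-> ->] := eq a b t ca cb t01 e.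
  move=> [[q cq <-] eq]; apply: map_f; apply/gext; split=> // a b t ca cb t01 e.
  have e' : phi q = lerp (phi a) (phi b) t by rewrite -rigid_lerp// e.
  have ca' : (phi @` Defs.conv g) (phi a) by exists a.
  have cb' : (phi @` Defs.conv g) (phi b) by exists b.
  by have [/phiI -> /phiI ->] := eq _ _ _ ca' cb' t01 e'.
Qed.

(** * Simple paths through points in convex position *)

Lemma sign_change (f : nat -> R) i j : (i <= j)%N ->
  (forall k, (i <= k <= j)%N -> f k != 0) -> f i * f j < 0 ->
  exists k, (i <= k < j)%N /\ f k * f k.+1 < 0.
Proof.
elim: j => [|j IHj].
  by rewrite leqn0 => /eqP -> _; rewrite -expr2 ltNge sqr_ge0.
rewrite leq_eqVlt => /predU1P[->|].
  by rewrite -expr2 ltNge sqr_ge0.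
rewrite ltnS => ij f0 fij.
have [fj|fj] := ltP (f i * f j) 0.
  have [|k [/andP[ik kj] fk]] := IHj ij _ fj.
    by move=> k /andP[ik kj]; apply: f0; rewrite ik leqW.
  by exists k; rewrite ik leqW.
exists j; rewrite ij leqnn; split=> //.
have fi0 : f i != 0 by apply: f0; rewrite leqnn leqW.
have fj0 : f j != 0 by apply: f0; rewrite ij leqnSn.
have fi2 : 0 < f i ^+ 2 by rewrite lt_neqAle sqr_ge0 eq_sym sqrf_eq0 fi0.
have fifj : 0 < f i * f j by rewrite lt_neqAle fj eq_sym mulf_neq0.
have e : f i ^+ 2 * (f j * f j.+1) = (f i * f j) * (f i * f j.+1) by ring.
by rewrite -(pmulr_rlt0 _ fi2) e pmulr_rlt0.
Qed.

Lemma sign_change_between (f : nat -> R) i j :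
  (forall k, (minn i j <= k <= maxn i j)%N -> f k != 0) -> f i * f j < 0 ->
  exists k, (minn i j <= k < maxn i j)%N /\ f k * f k.+1 < 0.
Proof.
have [ij|ij] := leqP i j => f0 fij; first exact: sign_change.
by apply: sign_change => //; [exact: ltnW|rewrite mulrC].
Qed.

(** The vertices visited up to a given time form a contiguous block of the hull
    boundary: no chord of this block separates two vertices visited later.
    Otherwise the suffix, going from one side of the chord to the other, has an
    edge that crosses the line of the chord; by convex position this edge in
    turn separates the ends of the chord, so the prefix has an edge that
    crosses the line of the suffix edge. The two edges then meet, against
    simplicity. *)
Lemma prefix_suffix_noncrossing g k i1 i2 j1 j2 : standard g ->
  (i1 <= k)%N -> (i2 <= k)%N -> (k < j1 < size g)%N -> (k < j2 < size g)%N ->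
  0 <= orient (nth (0, 0) g i1) (nth (0, 0) g i2) (nth (0, 0) g j1)
       * orient (nth (0, 0) g i1) (nth (0, 0) g i2) (nth (0, 0) g j2).
Proof.
move=> [gsimple guniq gext] i1k i2k /andP[kj1 j1g] /andP[kj2 j2g].
pose v := nth (0, 0) g.
have ext i : (i < size g)%N -> extreme (Defs.conv g) (v i).
  by move=> ig; apply/gext; exact: mem_nth.
have vI i j : (i < size g)%N -> (j < size g)%N -> (i < j)%N -> v i <> v j.
  by move=> ig jg ij /eqP; rewrite nth_uniq// ltn_eqF.
have closed := @conv_lerp_closed g.
rewrite leNgt; apply/negP => cross1.
have i12 : i1 <> i2.
  move=> e; move: cross1; rewrite e (_ : orient _ _ _ = 0) ?mul0r ?ltxx//.
  by rewrite orientE; ring.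
have v12 : v i1 <> v i2.
  case: (ltngtP i1 i2) => // ij; first by apply: vI; lia.
  by apply/nesym/vI; lia.
(* an edge of the suffix crosses the line of the chord of the prefix ... *)
have [|j [/andP[jl jr] crossj]] :=
    @sign_change_between (fun j => orient (v i1) (v i2) (v j)) j1 j2 _ cross1.
  move=> j jj; apply: (@extreme_orient_neq0 _ (Defs.conv g)) => //;
    try (apply: ext; lia); apply: vI; lia.
(* ... hence the line of this edge separates the ends of the chord *)
have cross2 : orient (v j) (v j.+1) (v i1) * orient (v j) (v j.+1) (v i2) < 0.
  by apply: (opposite_sides_sym closed _ _ _ _ crossj); apply: ext; lia.
have [|i [/andP[il ir] crossi]] :=
    @sign_change_between (fun i => orient (v j) (v j.+1) (v i)) i1 i2 _ cross2.
  move=> i ii; apply: (@extreme_orient_neq0 _ (Defs.conv g));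
    try (apply: ext; lia); first by apply: vI; lia.
  - by apply/nesym/vI; lia.
  - by apply/nesym/vI; lia.
have crossi' : orient (v i) (v i.+1) (v j) * orient (v i) (v i.+1) (v j.+1) < 0.
  by apply: (opposite_sides_sym closed _ _ _ _ crossi); apply: ext; lia.
have [t [u [t01 u01 tu]]] := segments_meet crossi' crossi.
have := gsimple i j t u _ _ t01 u01 tu.
move=> /(_ ltac:(lia) ltac:(lia)) e.
have ij : i%:R + 2 <= j%:R :> R by rewrite -natrD ler_nat; lia.
by move: t01 u01 => /andP[_ t1] /andP[u0 _]; move: e ij t1 u0; clear; lra.
Qed.

End Hull.

(** * Contacts, normal fans and clockwise arcs *)

Section Arcs.
Variable R : realType.
Implicit Types (g : seq (R * R)) (u v nu A B P U V W X Z : R * R).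

Lemma normal_fan_cross u v nu : cross u v < 0 -> nu <> (0, 0) ->
  cross nu v <= 0 -> cross u nu <= 0 -> normal_fan u v nu.
Proof.
move=> uv0 nu0 nuv unu; split=> //.
have n0 : cross u v != 0 by rewrite lt_eqF.
exists (cross nu v / cross u v), (cross u nu / cross u v).
split; rewrite ?divr_le0 ?mulr_le0 ?invr_le0 ?(ltW uv0)//.
by apply: pair_ext; rewrite /= /cross in n0 *; field.
Qed.

(** Seen from the boundary, the normals turn together with the contact points:
    a vertex [P] that the clockwise arc from [A] to [B] passes has all its
    normals between those of [A] and [B]. Indeed a normal of [P] is
    nonnegative on [P - A] and on [P - B], and the cone dual to these two
    vectors lies in the cone spanned by [u] and [v]. *)
Lemma contact_fan g u v A B P nu : cross u v < 0 ->
  contact g u A -> contact g v B -> contact g nu P -> nu <> (0, 0) ->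
  orient A P B < 0 -> normal_fan u v nu.
Proof.
move=> uv0 [[cA _] maxA] [[cB _] maxB] [[cP _] maxP] nu0 oAPB.
set x := dot P u - dot A u; set y := dot P v - dot A v.
set x1 := dot B u - dot A u; set y1 := dot B v - dot A v.
have x0 : x <= 0 by rewrite subr_le0 maxA.
have x10 : x1 <= 0 by rewrite subr_le0 maxA.
have y10 : 0 <= y1 by rewrite subr_ge0 maxB.
have yy1 : y <= y1 by rewrite lerD2r maxB.
(* The map (dot u, dot v) has determinant cross u v < 0, so in the coordinates
   x, y with origin A the clockwise turn A, P, B becomes counterclockwise *)
have D0 : 0 < x * y1 - y * x1.
  rewrite (_ : _ - _ = cross u v * orient A P B) ?nmulr_rgt0//.
  by rewrite /x /y /x1 /y1 /dot /cross orientE; ring.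
have g1 : cross nu v * x + cross u nu * y <= 0.
  rewrite (_ : _ + _ = cross u v * (dot P nu - dot A nu)).
    by rewrite nmulr_rle0// subr_ge0 maxP.
  by rewrite /x /y /dot /cross; ring.
have g2 : cross nu v * (x - x1) + cross u nu * (y - y1) <= 0.
  rewrite (_ : _ + _ = cross u v * (dot P nu - dot B nu)).
    by rewrite nmulr_rle0// subr_ge0 maxP.
  by rewrite /x /y /x1 /y1 /dot /cross; ring.
have y0 : 0 < y by nra.
have xx1 : 0 <= x - x1 by nra.
move: (cross nu v) (cross u nu) g1 g2 (@normal_fan_cross u v nu uv0 nu0).
move: x0 x10 y10 yy1 D0 y0 xx1; clear => x0 x10 y10 yy1 D0 y0 xx1 a b g1 g2.
apply.
- have e : a * (x * y1 - y * x1) = (y1 - y) * (a * x + b * y)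
      + y * (a * (x - x1) + b * (y - y1)) by ring.
  rewrite -(pmulr_lle0 _ D0) e -[leRHS]addr0.
  by apply: lerD; apply: mulr_ge0_le0 => //; [rewrite subr_ge0|exact: ltW].
- have e : b * (x * y1 - y * x1) = (x - x1) * (a * x + b * y)
      + - x * (a * (x - x1) + b * (y - y1)) by ring.
  rewrite -(pmulr_lle0 _ D0) e -[leRHS]addr0.
  by apply: lerD; apply: mulr_ge0_le0 => //; rewrite oppr_ge0.
Qed.

Lemma cw_next_lt g U V W : cw_next g U V -> extreme (Defs.conv g) W ->
  W <> U -> W <> V -> orient U V W < 0.
Proof.
move=> [EU EV UV right] EW WU WV; rewrite lt_neqAle right ?andbT; last by case: EW.
by apply: (extreme_orient_neq0 EU EV EW) => //; exact: nesym.
Qed.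

(** The direction of the edge turned by a quarter counterclockwise, which
    points outwards since the hull lies on the right of the edge. *)
Definition cw_normal U V : R * R := (- (V - U).2, (V - U).1).

Lemma dot_cw_normal U V X :
  dot X (cw_normal U V) - dot U (cw_normal U V) = orient U V X.
Proof. rewrite /dot orientE /=; ring. Qed.

Lemma cw_normal_outward g U V :
  cw_next g U V -> outward_normal g U V (cw_normal U V).
Proof.
move=> [EU EV UV right].
have UE y : Defs.conv g y -> dot y (cw_normal U V) <= dot U (cw_normal U V).
  by move=> cy; rewrite -subr_le0 dot_cw_normal; exact: right.
have VU : dot V (cw_normal U V) = dot U (cw_normal U V).
  by apply/eqP; rewrite -subr_eq0 dot_cw_normal orientE; apply/eqP; ring.
split; [|by split|by split=> // y; rewrite VU; exact: UE].
move=> [/eqP]; rewrite oppr_eq0 => /eqP/subr0_eq e2 /subr0_eq e1.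
exact/UV/esym/pair_ext.
Qed.

(** A third vertex [W] off the edge excludes the opposite normal, which would
    be outward as well if the hull were a segment. *)
Lemma outward_normal_cw g U V W nu : cw_next g U V ->
  extreme (Defs.conv g) W -> W <> U -> W <> V -> outward_normal g U V nu ->
  exists2 l : R, 0 < l & nu = (l * (cw_normal U V).1, l * (cw_normal U V).2).
Proof.
move=> UV EW WU WV [nu0 [[cU _] maxU] [[cV _] maxV]].
have oW := cw_next_lt UV EW WU WV.
have [EU EV neUV _] := UV.
set d1 := (V - U).1; set d2 := (V - U).2.
have s0 : d1 ^+ 2 + d2 ^+ 2 != 0.
  apply/eqP => /eqP; rewrite paddr_eq0 ?sqr_ge0// !sqrf_eq0.
  by move=> /andP[/eqP/subr0_eq e1 /eqP/subr0_eq e2]; apply/neUV/esym/pair_ext.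
have orth : nu.1 * d1 + nu.2 * d2 = 0.
  have : dot V nu = dot U nu by apply/eqP; rewrite eq_le maxU ?maxV.
  by move=> /eqP; rewrite -subr_eq0 => /eqP <-; rewrite /dot /d1 /d2 /=; ring.
set l := (nu.2 * d1 - nu.1 * d2) / (d1 ^+ 2 + d2 ^+ 2).
have nuE : nu = (l * (cw_normal U V).1, l * (cw_normal U V).2).
  apply: pair_ext; rewrite /= -/d1 -/d2 /l; apply: (mulfI s0).
    transitivity (- d2 * (nu.2 * d1 - nu.1 * d2)
                  + d1 * (nu.1 * d1 + nu.2 * d2)); first by ring.
    by rewrite orth; field.
  transitivity (d1 * (nu.2 * d1 - nu.1 * d2)
                + d2 * (nu.1 * d1 + nu.2 * d2)); first by ring.
  by rewrite orth; field.
exists l => //; rewrite lt_neqAle; apply/andP; split.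
  apply/eqP => l0; apply: nu0; rewrite nuE -l0.
  by apply: pair_ext; rewrite /= mul0r.
have [cW _] := EW.
rewrite -(nmulr_lle0 _ oW) -dot_cw_normal.
rewrite (_ : _ * _ = dot W nu - dot U nu) ?subr_le0 ?maxU//.
by rewrite [in RHS]nuE /dot /=; ring.
Qed.

Lemma cw_arc_extreme g A B n (V : nat -> R * R) j : (0 < n)%N ->
  cw_arc g A B n V -> (j <= n)%N -> extreme (Defs.conv g) (V j).
Proof.
move=> n0 [_ _ next _]; case: j => [|j] jn; first by have [] := next 0%N n0.
by have [] := next j jn.
Qed.

(** A convex polygon turns clockwise at any three of its vertices, not only
    at consecutive ones. Seen from [V i], the vertices beyond [V i.+1] lie in
    an open half plane bounded by the line of the first edge, where the
    clockwise order of directions is transitive, and consecutive vertices are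
    in this order. *)
Lemma cw_arc_clockwise g A B n (V : nat -> R * R) i j k : cw_arc g A B n V ->
  (i < j < k)%N -> (k <= n)%N -> orient (V i) (V j) (V k) < 0.
Proof.
move=> arc /andP[ij jk] kn; have [_ _ next inj] := arc.
have neq a b : (a <= n)%N -> (b <= n)%N -> a != b -> V a <> V b.
  by move=> an bn /eqP ab /(inj _ _ an bn).
have ext a : (a <= n)%N -> extreme (Defs.conv g) (V a).
  by apply: cw_arc_extreme arc; lia.
have first a : (i.+1 < a <= n)%N -> orient (V i) (V i.+1) (V a) < 0.
  move=> an; apply: cw_next_lt (next i _) _ _ _; [lia|apply: ext; lia|..];
    apply: neq; lia.
move: ij jk; rewrite leq_eqVlt => /predU1P[<- ik|ij jk].
  by apply: first; rewrite ik.
have step a : (i.+1 < a < n)%N -> orient (V i) (V a) (V a.+1) < 0.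
  move=> an; rewrite orient_cycle.
  apply: cw_next_lt (next a _) _ _ _; [lia|apply: ext; lia|..];
    apply: neq; lia.
elim: k jk kn => // k IHk; rewrite ltnS leq_eqVlt => /predU1P[<-|jk] kn.
  by apply: step; lia.
have [jr kr] : (i.+1 < j <= n)%N /\ (i.+1 < k < n)%N by lia.
have [kr1 kr2] : (i.+1 < k <= n)%N /\ (i.+1 < k.+1 <= n)%N by lia.
have fj := first j jr; have fk := first k kr1.
have fk1 := first k.+1 kr2; have sk := step k kr.
have {}IHk := IHk jk (ltnW kn).
(* Pluecker relation between the directions from V i to V i.+1, V j, V k and
   V k.+1 *)
rewrite -(nmulr_rgt0 _ fk) (_ : _ * _ =
  orient (V i) (V j) (V k) * orient (V i) (V i.+1) (V k.+1)
  + orient (V i) (V k) (V k.+1) * orient (V i) (V i.+1) (V j)).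
  by rewrite addr_gt0// nmulr_rgt0.
by rewrite !orientE; ring.
Qed.

(** An edge of the arc has an end other than [A] and [B], to which
    [contact_fan] applies, unless the arc is the single edge [AB]; its normal
    is then known up to a positive factor. *)
Lemma cw_arc_normal_fan g u v A B n (V : nat -> R * R) j W nu :
  cross u v < 0 -> contact g u A -> contact g v B -> cw_arc g A B n V ->
  (j < n)%N -> extreme (Defs.conv g) W -> W <> A -> W <> B ->
  outward_normal g (V j) (V j.+1) nu -> normal_fan u v nu.
Proof.
move=> uv0 cA cB arc jn EW WA WB out; have [nu0 cj cj1] := out.
have [V0 Vn next _] := arc.
have [j0|j0] := posnP j; last first.
  apply: contact_fan uv0 cA cB cj nu0 _; rewrite -V0 -Vn.
  by apply: cw_arc_clockwise arc _ _; rewrite ?j0.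
have [j1n|nj1] := ltnP j.+1 n.
  apply: contact_fan uv0 cA cB cj1 nu0 _; rewrite -V0 -Vn.
  by apply: cw_arc_clockwise arc _ _; rewrite ?j1n.
have VjA : V j = A by rewrite j0.
have VjB : V j.+1 = B by rewrite -Vn; congr V; lia.
move: (next j jn) out; rewrite VjA VjB => AB out.
have [l l0 nuE] := outward_normal_cw AB EW WA WB out.
move: cA cB => [[hA _] maxA] [[hB _] maxB].
apply: normal_fan_cross => //; rewrite nuE.
  rewrite (_ : cross _ _ = - l * (dot B v - dot A v)).
    by rewrite mulr_le0_ge0 ?oppr_le0 ?(ltW l0)// subr_ge0 maxB.
  by rewrite /cross /dot /=; ring.
rewrite (_ : cross _ _ = l * (dot B u - dot A u)).
  by rewrite mulr_ge0_le0 ?(ltW l0)// subr_le0 maxA.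
by rewrite /cross /dot /=; ring.
Qed.

Lemma down_notin_fan v : 0 < v.1 -> ~ normal_fan (0, 1) v (0, -1).
Proof.
move=> v0 [_ [a [b [a0 b0 /= [e1 e2]]]]].
have b00 : b = 0 by apply: (mulIf (lt0r_neq0 v0)); move: e1; lra.
by move: e2; rewrite b00; move: a0; clear; lra.
Qed.

End Arcs.

(** * The angle delta *)

Section Delta.
Variable R : realType.

(** The base is a variable because numerals denote unary naturals: this keeps
    conversion from evaluating the large ones. *)
Lemma thousands_gt0 (t : R) (m k : nat) : 0 < t ->
  0 < m.+1%:R * t ^+ 3 + k%:R.
Proof. by move=> t0; rewrite ltr_pwDl// mulr_gt0// exprn_gt0. Qed.

Lemma denominator_gt0 : 0 < 625 * 10 ^+ 3 + 565 :> R.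
Proof. exact: (thousands_gt0 624 565 (ltr0n R 10)). Qed.
Lemma denominator_neq0 : 625 * 10 ^+ 3 + 565 != 0 :> R.
Proof. exact/lt0r_neq0/denominator_gt0. Qed.

Lemma rho_gt0 : 0 < rho R.
Proof. exact: divr_gt0 (thousands_gt0 300 804 (ltr0n R 10)) denominator_gt0. Qed.

Lemma kappa_gt0 : 0 < kappa R.
Proof. exact: divr_gt0 (thousands_gt0 546 947 (ltr0n R 10)) denominator_gt0. Qed.

Lemma rho2Dkappa2 : rho R ^+ 2 + kappa R ^+ 2 = 1.
Proof.
have frac (p q d : R) : d != 0 -> p ^+ 2 + q ^+ 2 = d ^+ 2 ->
    (p / d) ^+ 2 + (q / d) ^+ 2 = 1.
  by move=> d0 e; rewrite !expr_div_n -mulrDl e divff// expf_neq0.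
by apply: (frac _ _ _ denominator_neq0); ring.
Qed.

Lemma cos_delta : cos (delta R) = kappa R.
Proof.
(* 766, 197 and the denominator are the legs and the squared hypotenuse of the
   triangle with angle beta *)
have cosE (x a b k d : R) : b != 0 -> d != 0 -> x = a / b ->
    a ^+ 2 + b ^+ 2 = d -> d - 2 * b ^+ 2 = k ->
    cos (pi - 2 * atan x) = k / d.
  move=> b0 d0 -> abd <-.
  rewrite mulr_natl mulr2n cosB cospi sinpi mul0r addr0 mulN1r.
  rewrite cosD -!expr2 sin2cos2 cos_atan exprVn sqr_sqrtr; last first.
    by rewrite addr_ge0 ?sqr_ge0.
  by rewrite -abd in d0 *; field; rewrite d0.
rewrite /delta /beta /kappa; apply: (cosE _ 766 197 _ _ _ denominator_neq0).
- by rewrite pnatr_eq0.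
- by [].
- by ring.
- by ring.
Qed.

Lemma delta_itv : 0 <= delta R <= pi.
Proof.
have b0 : 0 <= beta R by rewrite /beta -[leLHS](@atan0 R); apply: le_atan; lra.
have b1 : beta R < pi / 2 := atan_ltpi2 _.
by rewrite /delta; lra.
Qed.

(** If the unit vector [(k, r)] is at least as steep as [(x, - y)], its angle
    with the horizontal is at least as large. *)
Lemma cosine_lower_bound (r k x y s : R) : 0 < r -> 0 < k ->
  r ^+ 2 + k ^+ 2 = 1 -> y <= 0 -> 0 <= r * x + k * y -> 0 < x -> 0 < s ->
  s ^+ 2 = x ^+ 2 + y ^+ 2 -> k <= x / s.
Proof.
move=> r0 k0 rk y0 rxky x0 s0 s2; rewrite ler_pdivlMr//.
rewrite -(ler_pXn2r (ltn0Sn 1)) ?nnegrE ?mulr_ge0 ?(ltW k0) ?(ltW s0) ?(ltW x0)//.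
have le_ky : (k * - y) ^+ 2 <= (r * x) ^+ 2.
  rewrite ler_pXn2r// ?nnegrE ?mulr_ge0 ?oppr_ge0 ?(ltW k0) ?(ltW r0) ?(ltW x0)//.
  by move: rxky; clear; lra.
have e : x ^+ 2 = (r * x) ^+ 2 + (k * x) ^+ 2 by rewrite !exprMn -mulrDl rk mul1r.
rewrite exprMn s2 mulrDr -!exprMn e addrC lerD2r.
by rewrite -[k * y]opprK -mulrN sqrrN.
Qed.

Lemma acute_angle_delta (d w : R * R) : d.2 <= 0 ->
  0 <= rho R * d.1 + kappa R * d.2 -> 0 < d.1 -> 0 < w.1 -> w.2 = 0 ->
  acute_angle d w <= delta R.
Proof.
move=> d2 dz d1 w1 w2; rewrite /acute_angle.
have -> : enorm w = w.1.
  by rewrite /enorm /dot w2 mulr0 addr0 -expr2 sqrtr_sqr gtr0_norm.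
have -> : `|dot d w| / (enorm d * w.1) = d.1 / enorm d.
  rewrite /dot w2 mulr0 addr0 normrM !gtr0_norm// -mulf_div divff ?mulr1//.
  by rewrite gt_eqF.
have s2 : enorm d ^+ 2 = d.1 ^+ 2 + d.2 ^+ 2.
  by rewrite /enorm sqr_sqrtr /dot -!expr2// addr_ge0 ?sqr_ge0.
have s0 : 0 < enorm d.
  by rewrite sqrtr_gt0 /dot -!expr2 ltr_pwDl ?exprn_gt0 ?sqr_ge0.
have k1 := cosine_lower_bound rho_gt0 kappa_gt0 rho2Dkappa2 d2 dz d1 s0 s2.
have le1 : d.1 / enorm d <= 1.
  rewrite ler_pdivrMr// mul1r -(ler_pXn2r (ltn0Sn 1)) ?nnegrE ?(ltW s0) ?(ltW d1)//.
  by rewrite s2 lerDl sqr_ge0.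
have c0 : 0 <= d.1 / enorm d by rewrite divr_ge0 ?ltW.
have c1 : -1 <= d.1 / enorm d <= 1 by rewrite le1 andbT (le_trans _ c0)// oppr_le0.
rewrite leNgt; apply/negP => lt.
have : cos (acos (d.1 / enorm d)) < cos (delta R).
  by rewrite ltr_cos// in_itv /= ?delta_itv ?acos_ge0 ?acos_lepi.
rewrite acosK ?in_itv// cos_delta => lt'.
by have := lt_le_trans lt' k1; rewrite ltxx.
Qed.

End Delta.

(** * The crossing edge *)

Lemma exists_switch (P : pred nat) n : P 0%N -> ~~ P n ->
  exists j, [/\ (j < n)%N, P j & ~~ P j.+1].
Proof.
move=> P0; elim: n => [|n IHn] nPn; first by rewrite P0 in nPn.
have [Pn|nPn'] := boolP (P n); first by exists n.
by have [j [jn Pj nPj]] := IHn nPn'; exists j; split=> //; exact: ltnW.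
Qed.

(* [gamma0] is the minimizer, [gamma] the same path in the rigid coordinates of
   its selected gap [FT], and [M0] the vertex belonging to that gap. [M] is any
   upward contact, in particular [M0]. *)
Theorem lemma4p8 (R : realType) (gamma0 : seq (R * R))
    (phi : R * R -> R * R) (gamma : seq (R * R))
    (F T M0 : R * R) (h : R) (M Z1 : R * R) (n : nat) (V : nat -> R * R)
    (Hstd : standard gamma0) (Hnonconvex : ~ convex_path gamma0)
    (Hmin : minimizer gamma0) (Hlen : plength gamma0 < Dconst R)
    (Hphi : rigid phi) (Hgamma : gamma = map phi gamma0)
    (Hsel : selected_gap gamma F T M0 h)
    (HM : contact gamma (0, 1) M) (HZ1 : contact gamma (zetaR R) Z1)
    (Harc : cw_arc gamma M Z1 n V)
    (HMT : before gamma M T) (HTZ1 : before gamma T Z1) :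
  (exists j : nat, (0 < j <= n)%N /\
    [/\ [/\ before gamma F (V j.-1), before gamma (V j.-1) T &
            before gamma T (V j)],
        gap gamma (V j.-1) (V j),
        (forall nu : R * R, outward_normal gamma (V j.-1) (V j) nu ->
           normal_fan (0, 1) (zetaR R) nu) &
        acute_angle (V j - V j.-1) (T - F) <= delta R]) /\
  cos (delta R) = kappa R.
Proof.
split; last exact: cos_delta.
have gstd : standard gamma by rewrite Hgamma; exact: standard_rigid.
have [_ guniq gext] := gstd.
have [[[[FneT _] _] extM0 h0] [[strip F2 T2 M02 FT1] [FM0 M0T _]]] := Hsel.
have [Fg M0g iFM0] := FM0; have [_ Tg iM0T] := M0T.
have [Mg _ iMT] := HMT; have [_ Zg iTZ] := HTZ1.
have [extF extT] : extreme (Defs.conv gamma) F /\ extreme (Defs.conv gamma) T.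
  by split; apply/gext.
have ne X Y : (index X gamma < index Y gamma)%N -> X <> Y.
  by move=> + e; rewrite e ltnn.
have iMZ := ltn_trans iMT iTZ.
have iFT := ltn_trans iFM0 iM0T.
have [V0 Vn next inj] := Harc.
have n0 : (0 < n)%N.
  by case: posnP => // n0; case: (ne _ _ iMZ); rewrite -V0 -Vn n0.
have extV j : (j <= n)%N -> extreme (Defs.conv gamma) (V j).
  exact: cw_arc_extreme Harc.
have up_zeta : cross (0, 1) (zetaR R) < 0.
  by rewrite /cross /= mul0r mul1r sub0r oppr_lt0 rho_gt0.
have contM0 : contact gamma (0, 1) M0.
  split=> // y /strip/andP[_ yh].
  by rewrite /dot /= !mulr0 !mulr1 !add0r M02.
have bottom X : X \in gamma -> X.2 = 0 -> contact gamma (0, -1) X.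
  move=> /gext eX X2; split=> // y /strip/andP[y0 _].
  by rewrite /dot /= X2 !mulr0 !mulrN1 !add0r oppr0 oppr_le0.
have M2 : M.2 = h.
  have [[cM _] maxM] := HM; have /andP[_ Mh] := strip _ cM.
  apply/eqP; rewrite eq_le Mh /=; have [cM0 _] := extM0.
  by have := maxM _ cM0; rewrite /dot /= !mulr0 !mulr1 !add0r M02.
have down0 : (0, -1) <> (0, 0) :> R * R.
  by move=> [/eqP]; rewrite oppr_eq0 oner_eq0.
(* a bottom vertex has the downward normal, which is outside the fan of the arc *)
have avoid X j : X \in gamma -> X.2 = 0 -> X <> Z1 -> (j <= n)%N -> X <> V j.
  move=> Xg X2 XZ jn Xj.
  have [j0|j0] := posnP j.
    by move: X2; rewrite Xj j0 V0 M2 => h00; rewrite h00 ltxx in h0.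
  have [jn'|nj] := ltnP j n; last first.
    by apply: XZ; rewrite Xj -Vn; congr V; apply/eqP; rewrite eqn_leq jn nj.
  have oX : orient M X Z1 < 0.
    by rewrite Xj -V0 -Vn (cw_arc_clockwise Harc) ?j0.
  apply: (@down_notin_fan R (zetaR R)); first exact: rho_gt0.
  exact: contact_fan up_zeta HM HZ1 (bottom X Xg X2) down0 oX.
have FZ := ne _ _ (ltn_trans iFT iTZ).
have TZ := ne _ _ iTZ.
have FM : F <> M by move=> e; rewrite -e F2 in M2; rewrite M2 ltxx in h0.
have [||j [jn iUT iTV]] :=
    @exists_switch (fun j => index (V j) gamma < index T gamma)%N n.
- by rewrite V0.
- by rewrite Vn -leqNgt ltnW.
set U := V j in iUT *; set W := V j.+1 in iTV *.
have UW : cw_next gamma U W := next j jn.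
have [_ _ neUW _] := UW.
have Ug : U \in gamma by apply/gext/extV/ltnW.
have Wg : W \in gamma by apply/gext/extV.
have {}iTW : (index T gamma < index W gamma)%N.
  rewrite ltn_neqAle leqNgt iTV andbT; apply/eqP => iTWe.
  have TW : T <> W by apply: avoid.
  by apply: TW; rewrite -(nth_index (0, 0) Tg) iTWe nth_index.
have FU : F <> U by apply: avoid => //; exact: ltnW.
have FW : F <> W by apply: avoid.
have fan nu : outward_normal gamma U W nu -> normal_fan (0, 1) (zetaR R) nu.
  exact: cw_arc_normal_fan up_zeta HM HZ1 Harc jn extF FM FZ.
have nuUW := cw_normal_outward UW.
set nu0 := cw_normal U W in nuUW.
have [nu0n0 contU contW] := nuUW.
have [_ [a [b [a0 b0 nu0E]]]] := fan _ nuUW.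
have r0 := rho_gt0 R; have k0 := kappa_gt0 R.
have d2E : (W - U).2 = - (b * rho R).
  by have /(congr1 fst) := nu0E; rewrite /= mulr0 add0r => <-; rewrite opprK.
have d1E : (W - U).1 = a + b * kappa R.
  by have /(congr1 snd) := nu0E; rewrite /= mulr1.
(* if U came before F, the chord FU would separate the later vertices M0, W *)
have iFU : (index F gamma < index U gamma)%N.
  rewrite ltnNge; apply/negP => iUF.
  have iUM0 := leq_ltn_trans iUF iFM0.
  have iM0W := ltn_trans iM0T iTW.
  have M0F := nesym (ne _ _ iFM0).
  have UM0 := ne _ _ iUM0; have M0W := ne _ _ iM0W.
  have oFUW : orient F U W < 0.
    by rewrite orient_cycle; exact: (cw_next_lt UW extF FU FW).
  have nu01 : 0 < nu0.1.
    rewrite nu0E /= mulr0 add0r mulr_gt0// lt_neqAle b0 andbT.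
    apply/eqP => bz.
    (* the edge UW is horizontal, so three vertices lie on the top line *)
    have WU2 : W.2 = U.2.
      by apply: subr0_eq; move: d2E; rewrite -bz mul0r oppr0.
    have U2 : U.2 = h.
      have [[cU _] _] := contU; have [cM0 _] := extM0.
      have /andP[_ Uh] := strip _ cU; apply/eqP; rewrite eq_le Uh /=.
      have nu0v : nu0 = (0, a).
        by rewrite nu0E -bz; apply: pair_ext; rewrite /= !mul0r addr0 ?mulr0 ?mulr1.
      have aP : 0 < a.
        rewrite lt_neqAle a0 andbT; apply/eqP => az; apply: nu0n0.
        by rewrite nu0v -az.
      have [_ /(_ _ cM0)] := contU.
      by rewrite nu0v /dot /= !mulr0 !add0r M02 ler_pM2r.
    have := @extreme_orient_neq0 _ _ M0 U W extM0 (extV _ (ltnW jn)) (extV _ jn)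
      (nesym UM0) neUW M0W.
    by rewrite orientE WU2 U2 M02 subrr mul0r mulr0 subrr eqxx.
  have oFUM0 : 0 < orient F U M0.
    rewrite lt_neqAle eq_sym.
    rewrite (extreme_orient_neq0 extF (extV _ (ltnW jn)) extM0)//=; last exact: nesym.
    rewrite leNgt; apply/negP => oneg.
    apply: (down_notin_fan nu01).
    apply: contact_fan contM0 contU (bottom F Fg F2) down0 _.
      by rewrite /cross /= mul0r mul1r sub0r oppr_lt0.
    by rewrite orient_cycle.
  have := @prefix_suffix_noncrossing _ gamma (index F gamma)
    (index F gamma) (index U gamma) (index M0 gamma) (index W gamma) gstd
    (leqnn _) iUF.
  rewrite iFM0 (ltn_trans iFM0 iM0W) !index_mem M0g Wg !nth_index//.
  by move=> /(_ isT isT); rewrite leNgt pmulr_rlt0// oFUW.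
exists j.+1; split=> //=; split=> //.
- split.
    by split=> //; exists nu0.
  move=> [i ig]; have ig' := ltnW ig.
  have iE X k : (k < size gamma)%N -> nth (0, 0) gamma k = X -> index X gamma = k.
    by move=> kg <-; rewrite index_uniq.
  by move=> [[/iE e1 /iE e2]|[/iE e1 /iE e2]]; move: iUT iTW;
    rewrite e1// e2//; clear; lia.
have F1T : F.1 < T.1.
  rewrite lt_neqAle FT1 andbT; apply/eqP => e.
  by apply: FneT; apply: pair_ext; rewrite // F2 T2.
have d1n0 : (W - U).1 != 0.
  apply/eqP => d10; move: d1E; rewrite d10; move: (kappa R) k0 => k k0.
  move=> /esym/eqP; rewrite paddr_eq0 ?mulr_ge0 ?(ltW k0)//.
  rewrite mulf_eq0 (gt_eqF k0) orbF => /andP[/eqP az /eqP bz]; apply: nu0n0.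
  by rewrite nu0E az bz !mul0r !addr0.
apply: acute_angle_delta.
- by rewrite d2E oppr_le0; exact: mulr_ge0 b0 (ltW r0).
- rewrite d1E d2E (_ : _ + _ = rho R * a); last by ring.
  exact: mulr_ge0 (ltW r0) a0.
- rewrite lt_neqAle eq_sym d1n0 d1E andTb.
  exact: addr_ge0 a0 (mulr_ge0 b0 (ltW k0)).
- by rewrite /= subr_gt0.
- by rewrite /= F2 T2 subr0.
Qed.
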